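(* Let $A$ be a real symmetric $n\times n$ matrix and $b\in\mathbb{R}^n$ with $\|b\|_2=1$, and let $1\le k\le K$, where $K$ is the number of steps at which the Lanczos algorithm for $(A,b)$ terminates. Let $r(x)=M(x)/N(x)$ be a rational function, where $N$ is a polynomial with leading coefficient one that is nonzero at every eigenvalue of $A$, and $M$ is a polynomial sharing no common factors with $N$. Let $R$ be a polynomial for which the Lanczos-OR iterate $\mathsf{lan\text{-}OR}_k(r,R)$ is defined, and set $\tilde M(x)=M(x)R(x)$ and $\tilde N(x)=N(x)R(x)$. Then $\mathsf{lan\text{-}OR}_k(r,R)$ can be computed using $$\max\{\deg(\tilde M)+1,\;k+\lfloor \deg(\tilde N)/2\rfloor\}$$ matrix-vector products with $A$.
   Context: Computational model: $A$ is accessed only through matrix-vector products $v\mapsto Av$ (chosen adaptively), and $b$, $k$, $M$, $N$, $R$ are known; ''computed using $m$ matrix-vector products'' means that the exact value of the iterate is determined by these data together with the results of at most $m$ such products. All arithmetic is exact. Lanczos quantities: $q_0=b$, $q_{-1}=0$, $\beta_{-1}=0$, and for $j=0,1,\ldots$: $\alpha_j=q_j^{\mathsf T}Aq_j$, $\tilde q_{j+1}=Aq_j-\beta_{j-1}q_{j-1}-\alpha_jq_j$, $\beta_j=\|\tilde q_{j+1}\|_2$, $q_{j+1}=\tilde q_{j+1}/\beta_j$ if $\beta_j\neq 0$; the algorithm terminates at the first $K\le n$ with $\beta_{K-1}=0$. Then $\widehat Q=[q_0,\ldots,q_{K-1}]$ has orthonormal columns and $A\widehat Q=\widehat Q\widehat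 T$, where $\widehat T$ is the $K\times K$ symmetric tridiagonal matrix with diagonal $(\alpha_0,\ldots,\alpha_{K-1})$ and off-diagonal $(\beta_0,\ldots,\beta_{K-2})$. Let $Q=[q_0,\ldots,q_{k-1}]$. For a matrix $B$, $[B]_{:k,:k}$ denotes its leading $k\times k$ submatrix, and $e_0=(1,0,\ldots,0)^{\mathsf T}\in\mathbb{R}^k$. Lanczos-OR iterate: $$\mathsf{lan\text{-}OR}_k(r,R):=Q\,\big([\tilde N(\widehat T)]_{:k,:k}\big)^{-1}[\tilde M(\widehat T)]_{:k,:k}\,e_0,$$ defined whenever $[\tilde N(\widehat T)]_{:k,:k}$ is invertible. *)

(* Defs.v *)
From HB Require Import structures.
From mathcomp Require Import all_boot all_order all_algebra.
From mathcomp Require Import reals.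

Set Implicit Arguments.
Unset Strict Implicit.
Unset Printing Implicit Defensive.

Import Order.TTheory GRing.Theory Num.Theory.
Local Open Scope ring_scope.

Definition dotv (F : realType) n (u v : 'cV[F]_n) : F := (u^T *m v) 0 0.

(* The library norm on matrices is the sup norm, hence this one. *)
Definition norm2 (F : realType) n (v : 'cV[F]_n) : F := Num.sqrt (dotv v v).

Section Lanczos.

Variables (F : realType) (n : nat) (A : 'M[F]_n) (b : 'cV[F]_n).

(* The state after j steps is (q_(j-1), beta_(j-1), q_j).  Since x / 0 = 0,
   all the q_j past the termination index are 0. *)
Definition lanczos_step (s : 'cV[F]_n * F * 'cV[F]_n) :=
  let: (q', beta', q) := s in
  let qt := A *m q - beta' *: q' - dotv q (A *m q) *: q in
  (q, norm2 qt, (norm2 qt)^-1 *: qt).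

Definition lanczos_state (j : nat) := iter j lanczos_step (0, 0, b).

Definition lanczos_q (j : nat) : 'cV[F]_n := (lanczos_state j).2.

Definition lanczos_alpha (j : nat) : F :=
  dotv (lanczos_q j) (A *m lanczos_q j).

Definition lanczos_beta (j : nat) : F := (lanczos_state j.+1).1.2.

Definition lanczos_terminates_at (K : nat) : Prop :=
  [/\ (0 < K)%N, lanczos_beta K.-1 = 0 &
      forall j, (j < K.-1)%N -> lanczos_beta j != 0].

Definition lanczos_Q (k : nat) : 'M[F]_(n, k) :=
  \matrix_(i, j) lanczos_q j i 0.

Definition lanczos_T (K : nat) : 'M[F]_K :=
  \matrix_(i, j)
    (if i == j then lanczos_alpha i
     else if j == i.+1 :> nat then lanczos_beta i
     else if i == j.+1 :> nat then lanczos_beta j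
     else 0).

End Lanczos.

Definition leading_submx (F : realType) (m k : nat) (le_km : (k <= m)%N)
    (B : 'M[F]_m) : 'M[F]_k :=
  mxsub (widen_ord le_km) (widen_ord le_km) B.

Section LanczosOR.

(* The termination step is written K'.+1, as [horner_mx] needs a nonempty
   square matrix. *)
Variables (F : realType) (n : nat) (A : 'M[F]_n) (b : 'cV[F]_n).
Variables (K' k : nat) (le_kK : (k <= K'.+1)%N).
Variables M N R : {poly F}.

Definition lan_OR_lhs : 'M[F]_k :=
  leading_submx le_kK (horner_mx (lanczos_T A b K'.+1) (N * R)).

Definition lan_OR_rhs : 'M[F]_k :=
  leading_submx le_kK (horner_mx (lanczos_T A b K'.+1) (M * R)).

Definition lan_OR_defined : Prop := lan_OR_lhs \in unitmx.

Definition lan_OR : 'cV[F]_n :=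
  lanczos_Q A b k *m invmx lan_OR_lhs *m lan_OR_rhs
    *m (\col_(i < k) (i == 0 :> nat)%:R).

End LanczosOR.

(* Adaptive matrix-vector product algorithms in exact arithmetic: at each node
   the algorithm either outputs a vector, or asks for A *m v and continues in a
   way that depends arbitrarily on the answer. *)
Inductive matvec_alg (F : realType) (n : nat) : Type :=
  | Output of 'cV[F]_n
  | Query of 'cV[F]_n & ('cV[F]_n -> matvec_alg F n).

Fixpoint alg_output (F : realType) n (A : 'M[F]_n) (P : matvec_alg F n)
    : 'cV[F]_n :=
  match P with
  | Output x => x
  | Query v next => alg_output A (next (A *m v))
  end.

Fixpoint alg_matvecs (F : realType) n (A : 'M[F]_n) (P : matvec_alg F n)
    : nat :=
  match P with
  | Output _ => 0%N
  | Query v next => (alg_matvecs A (next (A *m v))).+1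
  end.

(* Main.v *)
Require Import Defs.
From HB Require Import structures.
From mathcomp Require Import all_boot all_order all_algebra.
From mathcomp Require Import reals.
From mathcomp Require Import zify.

Set Implicit Arguments.
Unset Strict Implicit.
Unset Printing Implicit Defensive.

Import Order.TTheory GRing.Theory Num.Theory.
Local Open Scope ring_scope.

(** The iterate sees [\hat T] only through the first [k] columns of
    [\tilde N(\hat T)] and the first column of [\tilde M(\hat T)], cut off after
    row [k].  The entry [(i, j)] of [\hat T^p] is a sum over the walks of length
    [p] from [j] to [i] that move by at most one index per step; such a walk
    cannot climb above [(i + j + p) / 2].  So the entries that matter depend
    only on a leading block of [\hat T], whose size [m] is the claimed number
    of products: [m] products [A q_0, ..., A q_(m-1)] are just what Lanczos
    needs to compute the leading [m * m] block and the [q_j], [j < m].  The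
    algorithm therefore runs [m] steps of Lanczos and evaluates the formula of
    the iterate with the [m * m] matrix in place of [\hat T]
    ([lan_OR_of_truncate]).

    The termination index [K] is unknown to the algorithm and may be smaller
    than [m].  Both situations are handled by comparing each finite matrix with
    one semi-infinite tridiagonal operator ([jacobi]): the cut at [m] is
    invisible because walks are too short to reach it, and the cut at [K] is
    invisible because [beta_(K-1) = 0] forbids crossing it
    ([tridiag_exp_jacobi]). *)

(** * Powers of truncated tridiagonal matrices *)

Definition tridiag (F : realType) (alpha beta : nat -> F) m : 'M[F]_m :=
  \matrix_(i, j)
    (if i == j then alpha i
     else if j == i.+1 :> nat then beta i
     else if i == j.+1 :> nat then beta j
     else 0).

(** The untruncated symmetric tridiagonal matrix, acting on sequences. *)
Definition jacobi (F : realType) (alpha beta : nat -> F) (f : nat -> F)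
    (i : nat) : F :=
  (if i is i'.+1 then beta i' * f i' else 0) + alpha i * f i
    + beta i * f i.+1.

Definition unit_seq (F : realType) (j : nat) : nat -> F :=
  fun l => (l == j)%:R.

Section Truncation.

Variables (F : realType) (alpha beta : nat -> F).

Local Notation J := (jacobi alpha beta).
Local Notation T := (tridiag alpha beta).

Lemma iter_jacobi_far p i j :
  (p + j < i)%N -> iter p J (unit_seq F j) i = 0.
Proof.
elim: p i => [|p IHp] [|i] //= lt_i.
  by rewrite /unit_seq; case: eqP => // eq_ij; lia.
by rewrite /jacobi !IHp ?mulr0 ?addr0 //; lia.
Qed.

Lemma sum_ord_pred1 m (a : nat) (g : nat -> F) :
  \sum_(l < m) (if l == a :> nat then g l else 0)
    = if (a < m)%N then g a else 0.
Proof.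
case: ifP => [lt_am | ge_am].
  rewrite (bigD1 (Ordinal lt_am)) //= eqxx big1 ?addr0 // => l.
  by rewrite -val_eqE /= => /negbTE->.
by rewrite big1 // => l _; case: eqP => // la; move: (ltn_ord l); rewrite la ge_am.
Qed.

(** In the last row the truncation drops the term [beta i * f i.+1]. *)
Lemma tridiag_mul_jacobi m (f : nat -> F) (i : 'I_m) :
  (i.+1 < m)%N || (beta i * f i.+1 == 0) ->
  \sum_(l < m) T m i l * f l = J f i.
Proof.
move=> cut_i; rewrite /jacobi.
pose diag l := if l == i :> nat then alpha l * f l else 0.
pose up l := if l == i.+1 :> nat then beta i * f l else 0.
pose down l := if (i == l.+1 :> nat) then beta l * f l else 0.
rewrite (eq_bigr (fun l : 'I_m => down l + diag l + up l)); last first.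
  move=> l _; rewrite mxE /down /diag /up -val_eqE /= [(i : nat) == l]eq_sym.
  case: eqP => [->|_].
    by rewrite ifN ?ifN ?add0r ?addr0 //; lia.
  case: eqP => [->|_]; first by rewrite ifN ?add0r //; lia.
  by case: eqP => [|_]; rewrite ?mul0r ?addr0.
rewrite !big_split /= (sum_ord_pred1 _ _ (fun l => alpha l * f l)).
rewrite (sum_ord_pred1 _ _ (fun l => beta i * f l)) ltn_ord; congr (_ + _ + _); last first.
  by case: ifP cut_i => //= _ /eqP.
rewrite /down; case: i {cut_i diag up down} => -[|i] lt_im /=; first by rewrite big1.
rewrite (eq_bigr (fun l : 'I_m => if l == i :> nat then beta l * f l else 0)).
  by rewrite (sum_ord_pred1 _ _ (fun l => beta l * f l)) ltnW.
by move=> l _; rewrite eqSS eq_sym.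
Qed.

(** A walk of length [p] from [j] to [i] crosses the cut between [m] and
    [m.+1] only if it is long enough to go there and back, and if the weight
    [beta m] of the crossing is nonzero. *)
Lemma tridiag_exp_jacobi m p (i j : 'I_m.+1) :
  (beta m == 0) || (i + j + p < m.+1.*2)%N ->
  (T m.+1 ^+ p) i j = iter p J (unit_seq F j) i.
Proof.
elim: p i => [|p IHp] i short; first by rewrite expr0 mxE.
rewrite exprS iterS -mulmxE mxE -tridiag_mul_jacobi.
  apply: eq_bigr => l _; rewrite [in LHS]mxE [in RHS]mxE -[i == l]val_eqE /=.
  (* The induction hypothesis needs [l <= i + 1]; beyond, [T i l = 0]. *)
  case: (boolP (l <= i.+1)%N) => [le_li | gt_li].
    by rewrite IHp //; case/orP: short => [->//|short]; apply/orP; right; lia.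
  by rewrite !ifN ?mul0r //; lia.
case: (ltnP i.+1 m.+1) => //= ge_im.
have ->: i = m :> nat by have := ltn_ord i; lia.
case/orP: short => [/eqP->|short]; first by rewrite mul0r.
by rewrite iter_jacobi_far ?mulr0 //; lia.
Qed.

Lemma horner_tridiag_jacobi m (p : {poly F}) (i j : 'I_m.+1) :
  (beta m == 0) || (i + j + (size p).-1 < m.+1.*2)%N ->
  horner_mx (T m.+1) p i j
    = \sum_(l < size p) p`_l * iter l J (unit_seq F j) i.
Proof.
move=> short; rewrite -[p in LHS]coefK poly_def rmorph_sum /= summxE.
apply: eq_bigr => l _.
rewrite linearZ /= rmorphXn /= horner_mx_X mxE tridiag_exp_jacobi //.
have le_l : (l <= (size p).-1)%N by rewrite -ltnS (ltn_predK (ltn_ord l)).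
case/orP: short => [->//|short]; apply/orP; right.
by apply: leq_ltn_trans short; rewrite leq_add2l.
Qed.

End Truncation.

(** * The iterate from finitely many Lanczos coefficients *)

Definition lan_OR_of (F : realType) n k (Q : 'M[F]_(n, k)) m
    (le_km : (k <= m.+1)%N) (T : 'M[F]_m.+1) (M N R : {poly F}) : 'cV[F]_n :=
  Q *m invmx (leading_submx le_km (horner_mx T (N * R)))
    *m leading_submx le_km (horner_mx T (M * R))
    *m (\col_(i < k) (i == 0 :> nat)%:R).

(** The degree bounds put the cut at [m.+1] out of reach of the relevant walks:
    those of [N * R] have both ends below [k], hence
    [2 * (k - 1) + deg (N * R) < 2 * m.+1]; those of [M * R] start at index 0,
    because only the first column of the right-hand side is used. *)
Lemma lan_OR_of_truncate (F : realType) n (A : 'M[F]_n) (b : 'cV[F]_n) k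
    (M N R : {poly F}) K' m (le_kK : (k <= K'.+1)%N) (le_km : (k <= m.+1)%N) :
  (0 < k)%N ->
  lanczos_beta A b K' = 0 ->
  ((size (M * R)%R).-1 <= m)%N ->
  (k + (size (N * R)%R).-1 %/ 2 <= m.+1)%N ->
  lan_OR A b le_kK M N R
    = lan_OR_of (lanczos_Q A b k) le_km (lanczos_T A b m.+1) M N R.
Proof.
move=> k_gt0 beta_K le_Mm le_Nm.
pose e0 : 'cV[F]_k := \col_(i < k) (i == 0 :> nat)%:R.
have TE l : lanczos_T A b l = tridiag (lanczos_alpha A b) (lanczos_beta A b) l.
  by [].
have col0 (B : 'M[F]_k) i : (B *m e0) i 0 = B i (Ordinal k_gt0).
  rewrite mxE (bigD1 (Ordinal k_gt0)) //= big1 ?addr0 ?mxE ?mulr1 // => j.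
  by rewrite -val_eqE /= mxE => /negbTE->; rewrite mulr0.
rewrite /lan_OR /lan_OR_of -!(mulmxA _ _ e0); congr (_ *m invmx _ *m _).
  apply/matrixP=> i j; rewrite !mxE !TE !horner_tridiag_jacobi ?beta_K ?eqxx //.
  apply/orP; right; move: le_Nm (ltn_ord i) (ltn_ord j) => /=.
  by move: (size _).-1 => dN; lia.
apply/colP=> i; rewrite !col0 !mxE !TE !horner_tridiag_jacobi ?beta_K ?eqxx //.
apply/orP; right; move: le_Mm (ltn_ord i) => /=.
by move: (size _).-1 => dM; lia.
Qed.

(** * Lanczos as an adaptive algorithm *)

(** [lanczos_step] with the matrix replaced by the answer to its only query. *)
Definition step_from (F : realType) n (s : 'cV[F]_n * F * 'cV[F]_n)
    (y : 'cV[F]_n) :=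
  let: (q', beta', q) := s in
  let qt := y - beta' *: q' - dotv q y *: q in
  (q, norm2 qt, (norm2 qt)^-1 *: qt).

Definition replay (F : realType) n (b : 'cV[F]_n) (ys : seq 'cV[F]_n) :=
  foldl (@step_from F n) (0, 0, b) ys.

(** [ys] accumulates the answers in order, so that the state of Lanczos, and
    with it the next query, is recovered by [replay]. *)
Fixpoint lanczos_alg (F : realType) n (b : 'cV[F]_n)
    (out : seq 'cV[F]_n -> 'cV[F]_n) (m : nat) (ys : seq 'cV[F]_n)
    : matvec_alg F n :=
  if m is m'.+1 then
    Query (replay b ys).2 (fun y => lanczos_alg b out m' (rcons ys y))
  else Output (out ys).

Section Replay.

Variables (F : realType) (n : nat) (A : 'M[F]_n) (b : 'cV[F]_n).

Definition lanczos_answers (j : nat) : seq 'cV[F]_n :=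
  mkseq (fun i => A *m lanczos_q A b i) j.

Lemma lanczos_answersS j :
  lanczos_answers j.+1 = rcons (lanczos_answers j) (A *m lanczos_q A b j).
Proof. exact: mkseqS. Qed.

Lemma replay_answers j : replay b (lanczos_answers j) = lanczos_state A b j.
Proof.
elim: j => // j IHj; rewrite lanczos_answersS /replay foldl_rcons.
rewrite -/(replay _ _) IHj /lanczos_q /lanczos_state iterS.
by case: (iter j _ _) => -[].
Qed.

Lemma take_answers i m :
  (i <= m)%N -> take i (lanczos_answers m) = lanczos_answers i.
Proof.
by move=> le_im; rewrite /lanczos_answers /mkseq -map_take take_iota (minn_idPl _).
Qed.

Lemma lanczos_alg_output out m j :
  alg_output A (lanczos_alg b out m (lanczos_answers j))
    = out (lanczos_answers (m + j)).
Proof.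
elim: m j => //= m IHm j.
by rewrite replay_answers -/(lanczos_q A b j) -lanczos_answersS IHm addnS.
Qed.

Lemma lanczos_alg_matvecs out m ys :
  alg_matvecs A (lanczos_alg b out m ys) = m.
Proof. by elim: m ys => //= m IHm ys; rewrite IHm. Qed.

End Replay.

Definition replay_Q (F : realType) n (b : 'cV[F]_n) k (ys : seq 'cV[F]_n) :
    'M[F]_(n, k) :=
  \matrix_(i, j) (replay b (take j ys)).2 i 0.

Definition replay_T (F : realType) n (b : 'cV[F]_n) m (ys : seq 'cV[F]_n) :
    'M[F]_m :=
  tridiag (fun i => dotv (replay b (take i ys)).2 (nth 0 ys i))
          (fun i => (replay b (take i.+1 ys)).1.2) m.

Lemma replay_Q_answers (F : realType) n (A : 'M[F]_n) b k m :
  (k <= m)%N -> replay_Q b k (lanczos_answers A b m) = lanczos_Q A b k.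
Proof.
move=> le_km; apply/matrixP=> i j; rewrite !mxE take_answers ?replay_answers //.
by have := ltn_ord j; lia.
Qed.

Lemma replay_T_answers (F : realType) n (A : 'M[F]_n) b m :
  replay_T b m (lanczos_answers A b m) = lanczos_T A b m.
Proof.
apply/matrixP=> i j; have [lt_im lt_jm] := (ltn_ord i, ltn_ord j); rewrite !mxE.
by rewrite !take_answers ?nth_mkseq ?replay_answers // ltnW.
Qed.

Theorem corollary2p6 (F : realType) (n : nat) (b : 'cV[F]_n) (k : nat)
    (M N R : {poly F}) (norm_b : norm2 b = 1) (k_gt0 : (1 <= k)%N)
    (N_monic : N \is monic) (coprime_MN : coprimep M N) :
  exists P : matvec_alg F n,
    forall (A : 'M[F]_n) (K' : nat) (le_kK : (k <= K'.+1)%N),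
      A^T = A ->
      lanczos_terminates_at A b K'.+1 ->
      (forall a : F, eigenvalue A a -> N.[a] != 0) ->
      lan_OR_defined A b le_kK N R ->
      alg_output A P = lan_OR A b le_kK M N R /\
      (alg_matvecs A P <=
         maxn ((size (M * R)%R).-1 + 1) (k + (size (N * R)%R).-1 %/ 2))%N.
Proof.
set bound := maxn _ _.
have [m bound_m] : exists m, bound = m.+1 by exists bound.-1; lia.
have le_km : (k <= m.+1)%N by lia.
pose out ys := lan_OR_of (replay_Q b k ys) le_km (replay_T b m.+1 ys) M N R.
exists (lanczos_alg b out m.+1 [::]) => A K' le_kK _ [_ beta_K _] _ _.
rewrite lanczos_alg_matvecs bound_m; split=> //.
rewrite (lanczos_alg_output A b out m.+1 0) addn0 /out.
rewrite replay_Q_answers // replay_T_answers.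
symmetry; apply: lan_OR_of_truncate => //.
  by rewrite -ltnS -bound_m -addn1 leq_maxl.
by rewrite -bound_m leq_maxr.
Qed.
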